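(* Let $\mathcal{L}$ be an L$\varepsilon$-sound logic (a set of sequents in the language of $\backslash,\wedge,\mathbf{1}$, each of which is true in all L$\varepsilon$-models) which includes $\mathbf{L}^{+\varepsilon}(\backslash,\wedge,\mathbf{1})$ (every sequent derivable in $\mathbf{L}^{+\varepsilon}(\backslash,\wedge,\mathbf{1})$ belongs to $\mathcal{L}$). Then the derivability problem for $\mathcal{L}$ (given a sequent, decide whether it belongs to $\mathcal{L}$) is undecidable.
   Context: **Syntax.** Formulae are built from a countable set of variables and the constant $\mathbf{1}$ by the binary connectives $\backslash$ and $\wedge$. Sequents are $\Gamma\vdash C$ with $\Gamma$ a finite, possibly empty, sequence of formulae and $C$ a formula. **The calculus $\mathbf{L}^{+\varepsilon}(\backslash,\wedge,\mathbf{1})$** (no cut rule) has axioms $A\vdash A$ and $A,\mathbf{1}\vdash A$, and rules (premises before $\Rightarrow$, conclusion after): - $(\backslash L)$: $\Pi\vdash A$ and $\Gamma,B,\Delta\vdash C$ $\Rightarrow$ $\Gamma,\Pi,A\backslash B,\Delta\vdash C$; $(\backslash R)$: $A,\Pi\vdash B$ $\Rightarrow$ $\Pi\vdash A\backslash B$; - $(\wedge L_l)$: $\Gamma,A,\Delta\vdash C$ $\Rightarrow$ $\Gamma,A\wedge B,\Delta\vdash C$; $(\wedge L_r)$: $\Gamma,B,\Delta\vdash C$ $\Rightarrow$ $\Gamma,A\wedge B,\Delta\vdash C$; $(\wedge R)$: $\Pi\vdash A$ and $\Pi\vdash B$ $\Rightarrow$ $\Pi\vdash A\wedge B$; - $(L\varepsilon)$: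 $\Gamma,A,\mathbf{1}\wedge G,\Delta\vdash C$ $\Rightarrow$ $\Gamma,\mathbf{1}\wedge G,A,\Delta\vdash C$; - $(R\varepsilon)$: $\Gamma,\mathbf{1}\wedge G,A,\Delta\vdash C$ $\Rightarrow$ $\Gamma,A,\mathbf{1}\wedge G,\Delta\vdash C$; - $(D\varepsilon)$: $\Gamma,\mathbf{1}\wedge G,\mathbf{1}\wedge G,\Delta\vdash C$ $\Rightarrow$ $\Gamma,\mathbf{1}\wedge G,\Delta\vdash C$. **L$\varepsilon$-models.** An L$\varepsilon$-model over an alphabet (set) $\Sigma$ is a map $w$ from formulae to subsets of $\Sigma^*$ with $w(A\backslash B)=\{u\in\Sigma^*\mid \forall v\in w(A)\; vu\in w(B)\}$, $w(A\wedge B)=w(A)\cap w(B)$, $w(\mathbf{1})=\{\varepsilon\}$ ($\varepsilon$ is the empty word); values on variables are arbitrary. A sequent $A_1,\dots,A_n\vdash B$ ($n\ge1$) is true in $w$ if $w(A_1)\cdots w(A_n)\subseteq w(B)$ (elementwise concatenation); $\vdash B$ is true if $\varepsilon\in w(B)$. *)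

(* Defs.v *)
From mathcomp Require Import all_boot.

Set Implicit Arguments.
Unset Strict Implicit.
Unset Printing Implicit Defensive.

(* Under A B is A \ B (divisor on the left); And is additive conjunction. *)
Inductive formula : Type :=
  | Var of nat
  | One
  | Under of formula & formula
  | And of formula & formula.

Definition sequent : Type := (seq formula * formula)%type.

(* The calculus L^{+epsilon}(\, /\, 1). Antecedents may be empty everywhere,
   in particular in under_R. There is no cut rule. *)
Reserved Notation "G |~ C" (at level 70, no associativity).

Inductive derivable : seq formula -> formula -> Prop :=
  | ax_id A :
      [:: A] |~ A
  | ax_one A :
      [:: A; One] |~ A
  | under_L Gamma Pi Delta A B C :
      Pi |~ A -> Gamma ++ B :: Delta |~ C ->
      Gamma ++ Pi ++ Under A B :: Delta |~ C
  | under_R Pi A B :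
      A :: Pi |~ B ->
      Pi |~ Under A B
  | and_Ll Gamma Delta A B C :
      Gamma ++ A :: Delta |~ C ->
      Gamma ++ And A B :: Delta |~ C
  | and_Lr Gamma Delta A B C :
      Gamma ++ B :: Delta |~ C ->
      Gamma ++ And A B :: Delta |~ C
  | and_R Pi A B :
      Pi |~ A -> Pi |~ B ->
      Pi |~ And A B
  | eps_L Gamma Delta A G C :
      Gamma ++ A :: And One G :: Delta |~ C ->
      Gamma ++ And One G :: A :: Delta |~ C
  | eps_R Gamma Delta A G C :
      Gamma ++ And One G :: A :: Delta |~ C ->
      Gamma ++ A :: And One G :: Delta |~ C
  | eps_D Gamma Delta G C :
      Gamma ++ And One G :: And One G :: Delta |~ C ->
      Gamma ++ And One G :: Delta |~ C
where "G |~ C" := (derivable G C).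

Definition language (Sigma : Type) : Type := seq Sigma -> Prop.

Record Leps_model (Sigma : Type) : Type := LepsModel {
  interp :> formula -> language Sigma;
  interp_under : forall A B u,
    interp (Under A B) u <-> (forall v, interp A v -> interp B (v ++ u));
  interp_and : forall A B u,
    interp (And A B) u <-> interp A u /\ interp B u;
  interp_one : forall u, interp One u <-> u = [::]
}.

(* w(A_1) ... w(A_n); the empty product is {epsilon}, so that an empty
   antecedent makes [true_in] say that epsilon belongs to w(B). *)
Fixpoint antecedent_lang Sigma (w : formula -> language Sigma)
    (Gamma : seq formula) : language Sigma :=
  if Gamma is A :: Gamma' then
    fun u => exists v1 v2,
      [/\ u = v1 ++ v2, w A v1 & antecedent_lang w Gamma' v2]
  else fun u => u = [::].

Definition true_in Sigma (w : Leps_model Sigma) (s : sequent) : Prop :=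
  forall u, antecedent_lang w s.1 u -> w s.2 u.

Definition Leps_sound (L : sequent -> Prop) : Prop :=
  forall s, L s -> forall (Sigma : Type) (w : Leps_model Sigma), true_in w s.

Definition includes_Leps_calculus (L : sequent -> Prop) : Prop :=
  forall Gamma C, Gamma |~ C -> L (Gamma, C).

(* Partial recursive functions, as terms indexed by their arity. *)
Inductive recfun : nat -> Type :=
  | Zero n : recfun n
  | Succ : recfun 1
  | Proj n : 'I_n -> recfun n
  | Comp k n : recfun k -> ('I_k -> recfun n) -> recfun n
  | PrimRec n : recfun n -> recfun n.+2 -> recfun n.+1
  | Mu n : recfun n.+1 -> recfun n.

(* [computes f xs y]: f is defined on xs and has value y there. In a primitive
   recursion the first argument is the recursion variable, and the step takes
   (index, previous value, parameters). In a minimization the first argument is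
   the one searched, and all values before the zero have to be defined. *)
Fixpoint computes n (f : recfun n) : n.-tuple nat -> nat -> Prop :=
  match f in recfun n return n.-tuple nat -> nat -> Prop with
  | Zero _ => fun _ y => y = 0
  | Succ => fun xs y => y = (thead xs).+1
  | Proj _ i => fun xs y => y = tnth xs i
  | Comp k _ g h => fun xs y =>
      exists2 zs : k.-tuple nat,
        forall i, computes (h i) xs (tnth zs i) & computes g zs y
  | PrimRec _ g h => fun xs =>
      let ps := [tuple of behead xs] in
      (fix rec m : nat -> Prop :=
         if m is m'.+1 then
           fun y => exists2 z, rec m' z & computes h [tuple of m' :: z :: ps] y
         else computes g ps) (thead xs)
  | Mu _ g => fun xs y =>
      computes g [tuple of y :: xs] 0 /\
      (forall i, i < y -> exists z, computes g [tuple of i :: xs] z.+1)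
  end.

Lemma computes_functional n (f : recfun n) xs y y' :
  computes f xs y -> computes f xs y' -> y = y'.
Proof.
elim: f xs y y' => {n} [n|||k n g IHg h IHh|n g IHg h IHh|n g IHg] xs y y' /=.
- by move=> -> ->.
- by move=> -> ->.
- by move=> ? ? -> ->.
- case=> zs zsP gy [zs' zs'P gy'].
  suff ezs : zs = zs' by rewrite -ezs in gy'; exact: IHg gy gy'.
  by apply: eq_from_tnth => i; apply: IHh (zsP i) (zs'P i).
- elim: (thead xs) y y' => [|m IHm] y y'; first exact: IHg.
  by case=> z rz hy [z' rz' hy']; rewrite -(IHm _ _ rz rz') in hy'; apply: IHh hy hy'.
- case=> gy ly [gy' ly']; case: (ltngtP y y') => // [/ly'|/ly] [z gz].
  + by have := IHg _ _ _ gy gz.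
  + by have := IHg _ _ _ gy' gz.
Qed.

(* Cantor pairing (x + y)(x + y + 1)/2 + y. *)
Definition cpair (x y : nat) : nat := 'C((x + y).+1, 2) + y.

Fixpoint code_formula (A : formula) : nat :=
  match A with
  | Var n => cpair 0 n
  | One => cpair 1 0
  | Under A B => cpair 2 (cpair (code_formula A) (code_formula B))
  | And A B => cpair 3 (cpair (code_formula A) (code_formula B))
  end.

Fixpoint code_seq (Gamma : seq formula) : nat :=
  if Gamma is A :: Gamma' then (cpair (code_formula A) (code_seq Gamma')).+1
  else 0.

Definition code_sequent (s : sequent) : nat :=
  cpair (code_seq s.1) (code_formula s.2).

Lemma cpair_inj x y x' y' : cpair x y = cpair x' y' -> x = x' /\ y = y'.
Proof.
have lt_cpair a b c d : a + b < c + d -> cpair a b < cpair c d.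
  move=> lt_s; apply: (@leq_trans 'C((a + b).+2, 2)).
    by rewrite /cpair [leqRHS]binS bin1 ltn_add2l ltnS leq_addl.
  by apply: leq_trans (leq_addr _ _); apply: leq_bin2l.
case: (ltngtP (x + y) (x' + y')) => [/lt_cpair|/lt_cpair|e].
- by move=> lt_c e; rewrite e ltnn in lt_c.
- by move=> lt_c e; rewrite e ltnn in lt_c.
- by rewrite /cpair e => /addnI ey; move: e; rewrite ey => /addIn.
Qed.

Lemma code_formula_inj : injective code_formula.
Proof.
elim=> [n||A IHA B IHB|A IHA B IHB] [m||A' B'|A' B'] /cpair_inj[] // _.
- by move=> ->.
- by case/cpair_inj=> /IHA-> /IHB->.
- by case/cpair_inj=> /IHA-> /IHB->.
Qed.

Lemma code_sequent_inj : injective code_sequent.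
Proof.
have code_seq_inj : injective code_seq.
  elim=> [|A G IHG] [|A' G'] //= [] /cpair_inj[].
  by move=> /code_formula_inj-> /IHG->.
by case=> [G C] [G' C'] /cpair_inj[/=] /code_seq_inj-> /code_formula_inj->.
Qed.

(* A total recursive characteristic function on the codes of sequents. *)
Definition sequent_decider (L : sequent -> Prop) (f : recfun 1) : Prop :=
  forall s : sequent,
    (L s -> computes f [tuple code_sequent s] 1) /\
    (~ L s -> computes f [tuple code_sequent s] 0).

Definition derivability_decidable (L : sequent -> Prop) : Prop :=
  exists f : recfun 1, sequent_decider L f.

(* Main.v *)
Require Import Defs.
From mathcomp Require Import all_boot.
From Stdlib Require Import Setoid.

Set Implicit Arguments.
Unset Strict Implicit.
Unset Printing Implicit Defensive.

(* A formula 1 /\ G denotes {epsilon} if G holds at epsilon and the empty set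
   otherwise, and it can be moved and duplicated in an antecedent; so it acts as
   a reusable hypothesis G, which can state rules A1, ..., An |- p for
   variables p.

   Write a tuple of numbers as the word of the blocks a^x b, where a and b are
   variables interpreted by singletons. Over these words the rules define a
   conjunctive grammar, and a \ B, the left quotient of B by a, adds the
   existential quantifier that grammars lack. By induction on f, the graph of
   every partial recursive f is therefore denoted by a formula relative to
   suitable rules, in the following double sense: the rules hold in a model in
   which the formula is interpreted exactly by the graph, and every word of the
   graph is derivable from the rules in the calculus.

   If f decides L, there is then a G such that, for all x, the sequent
   a^x b, 1 /\ G |- p belongs to L iff f answers 0 on the code of a^x b, H |- p,
   where x is the code of H. Taking H = 1 /\ G is a contradiction. *)

(** * Derivations under a reusable hypothesis *)

(** The hypothesis stands at the right end, so that [under_R], which takes its formula from the left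
    end, applies unchanged. *)
Definition proves (G : formula) (Gamma : seq formula) (C : formula) : Prop :=
  Gamma ++ [:: And One G] |~ C.

Lemma eps_shift G Gamma Pi Delta C :
  Gamma ++ And One G :: Pi ++ Delta |~ C ->
  Gamma ++ Pi ++ And One G :: Delta |~ C.
Proof.
elim: Pi Gamma => [|A Pi IH] Gamma //= /(@eps_R _ (Pi ++ Delta)) p.
by rewrite -cat_rcons; apply: IH; rewrite cat_rcons.
Qed.

(** The inner copy travels right by [eps_R] and merges with the last one by [eps_D]; in this way the
    premises of a rule share one hypothesis. *)
Lemma eps_absorb G Gamma Delta C :
  Gamma ++ And One G :: Delta ++ [:: And One G] |~ C ->
  proves G (Gamma ++ Delta) C.
Proof.
by move=> /eps_shift; rewrite catA => /eps_D; rewrite /proves.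
Qed.

Lemma proves_id G A : proves G [:: A] A.
Proof. exact: (@and_Ll [:: A] [::] _ _ _ (ax_one A)). Qed.

Lemma proves_one G : proves G [::] One.
Proof. exact: (@and_Ll [::] [::] _ _ _ (ax_id One)). Qed.

Lemma proves_underR G Pi A B : proves G (A :: Pi) B -> proves G Pi (Under A B).
Proof. exact: under_R. Qed.

Lemma proves_andR G Pi A B :
  proves G Pi A -> proves G Pi B -> proves G Pi (And A B).
Proof. exact: and_R. Qed.

Lemma proves_underL G Gamma Pi Delta A B C :
  proves G Pi A -> proves G (Gamma ++ B :: Delta) C ->
  proves G (Gamma ++ Pi ++ Under A B :: Delta) C.
Proof.
rewrite {1 2}/proves -[(Gamma ++ _) ++ _]catA => PA GC.
rewrite catA; apply: eps_absorb.
by have := under_L PA GC; rewrite -!catA.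
Qed.

(** Phrased as the removal of [h] from any place of an antecedent, because there is no cut rule
    through which [h] could be supplied. This form passes to conjuncts. *)
Definition available (G h : formula) : Prop :=
  forall Gamma Delta C, proves G (Gamma ++ h :: Delta) C ->
                        proves G (Gamma ++ Delta) C.

Lemma available_self G : available G G.
Proof.
move=> Ga D C; rewrite {1}/proves -catA /= => p.
by apply: eps_absorb; apply: and_Lr p.
Qed.

Lemma available_andl G h h' : available G (And h h') -> available G h.
Proof.
move=> av Ga D C; rewrite {1}/proves -catA /= => p.
by apply: av; rewrite /proves -catA; apply: and_Ll p.
Qed.

Lemma available_andr G h h' : available G (And h h') -> available G h'.
Proof.
move=> av Ga D C; rewrite {1}/proves -catA /= => p.
by apply: av; rewrite /proves -catA; apply: and_Lr p.
Qed.

Lemma available_rule1 G A p Pi :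
  available G (Under A p) -> proves G Pi A -> proves G Pi p.
Proof.
move=> av PA; rewrite -[Pi]cats0; apply: av.
exact: (@proves_underL G [::] _ [::] _ _ _ PA (proves_id _ _)).
Qed.

(** The last factor is the outermost divisor: [under_L] first consumes the block next to the
    formula. *)
Lemma available_rule2 G A B p Pi Pi' :
  available G (Under B (Under A p)) -> proves G Pi A -> proves G Pi' B ->
  proves G (Pi ++ Pi') p.
Proof.
move=> av PA PB; rewrite -[Pi ++ _]cats0; apply: av; rewrite -catA.
apply: proves_underL => //.
exact: (@proves_underL G [::] _ [::] _ _ _ PA (proves_id _ _)).
Qed.

Lemma available_rule3 G A B C p Pi Pi' Pi'' :
  available G (Under C (Under B (Under A p))) ->
  proves G Pi A -> proves G Pi' B -> proves G Pi'' C ->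
  proves G (Pi ++ Pi' ++ Pi'') p.
Proof.
move=> av PA PB PC; rewrite catA -[_ ++ Pi'']cats0; apply: av; rewrite -!catA.
rewrite [Pi ++ _]catA; apply: proves_underL => //.
rewrite -catA; apply: proves_underL => //.
exact: (@proves_underL G [::] _ [::] _ _ _ PA (proves_id _ _)).
Qed.

(** * Rules evaluated in models *)

Fixpoint eval Sigma (V : nat -> language Sigma) (A : formula) :
    language Sigma :=
  match A with
  | Var n => V n
  | One => fun u => u = [::]
  | Under A B => fun u => forall v, eval V A v -> eval V B (v ++ u)
  | And A B => fun u => eval V A u /\ eval V B u
  end.

Definition eval_model Sigma (V : nat -> language Sigma) : Leps_model Sigma.
Proof. by exists (eval V). Defined.

Lemma eval_rule1 Sigma (V : nat -> language Sigma) A p :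
  eval V (Under A p) [::] <-> (forall u, eval V A u -> eval V p u).
Proof. by split=> h u /= /h; rewrite cats0. Qed.

Lemma eval_rule2 Sigma (V : nat -> language Sigma) A B p :
  eval V (Under B (Under A p)) [::] <->
  (forall u v, eval V A u -> eval V B v -> eval V p (u ++ v)).
Proof.
split=> /= h u => [v Au Bv|Bu v Av]; last by rewrite cats0; apply: h.
by have := h _ Bv _ Au; rewrite cats0.
Qed.

(** * Tuples of numbers as words over two letters *)

(** Through the coercion of [bool] to [nat], [b] is variable 0 and [a] is variable 1. Variable 2
    will be the goal of the queries, hence the bound [2 < N] on fresh variables. *)
Definition letter (c : bool) : formula := Var c.

Definition word (u : seq bool) : seq formula := map letter u.

Definition relation := seq nat -> Prop.

Fixpoint enc (s : seq nat) : seq bool :=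
  if s is x :: s' then nseq x true ++ false :: enc s' else [::].

Lemma enc_cat s t : enc (s ++ t) = enc s ++ enc t.
Proof. by elim: s => //= x s ->; rewrite -catA. Qed.

Lemma enc_inj : injective enc.
Proof.
elim=> [|x s IH] [|y t] //=; try by case: x || case: y.
elim: x y => [|x IHx] [|y] //=; first by case=> /IH ->.
by case=> /IHx[-> ->].
Qed.

Definition enc_lang (R : relation) : language bool :=
  fun u => exists2 s, R s & u = enc s.

Lemma enc_langE R s : enc_lang R (enc s) <-> R s.
Proof. by split=> [[t Rt /enc_inj ->]|Rs] //; exists s. Qed.

Definition derived (G A : formula) : relation :=
  fun s => proves G (word (enc s)) A.

(** * Operators on relations captured by formulae *)

Definition agree (N N' : nat) (V v : nat -> language bool) : Prop :=
  forall i, N <= i < N' -> V i = v i.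

(** Successive constructions use adjacent intervals of variables; their interpretations are glued at
    [N]. *)
Definition splice (N : nat) (v v' : nat -> language bool) i :=
  if i < N then v i else v' i.

Lemma agree_splice N N1 N2 V v v' :
  N <= N1 -> N1 <= N2 -> agree N N2 V (splice N1 v v') ->
  agree N N1 V v /\ agree N1 N2 V v'.
Proof.
move=> l1 l2 ag; split=> i /andP[l l'].
  by rewrite ag /splice ?l' // l (leq_trans l').
by rewrite ag /splice ?(leq_trans l1) // ltnNge l.
Qed.

Definition reads_letters (V : nat -> language bool) : Prop :=
  forall c : bool, V c = fun u => u = [:: c].

Definition intended (p : nat) (X : relation) (V : nat -> language bool) :=
  reads_letters V /\ V p = enc_lang X.

(* The operator [F] is captured by a formula [A], relative to a hypothesis [h]
   over the fresh variables in [N, N'), with the argument of [F] sitting in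
   the variable [p]. The first half speaks about intended models only, the
   second about derivations under any theory containing [h]. *)
Definition captures (F : relation -> relation) (N p N' : nat)
    (v : relation -> nat -> language bool) (h A : formula) : Prop :=
  (forall X V, intended p X V -> agree N N' V (v X) ->
     eval V h [::] /\ forall u, eval V A u <-> enc_lang (F X) u) /\
  (forall G, available G h ->
     forall s, F (derived G (Var p)) s -> derived G A s).

(** Operators rather than relations, so that recursive definitions become least fixed points; a
    relation is a constant operator. Quantifying over [N] lets constructions be chained on disjoint
    variables. *)
Definition definable (F : relation -> relation) : Prop :=
  forall N p, 2 < N -> p < N ->
  exists N' v h A, N <= N' /\ captures F N p N' v h A.

Lemma definable_ext F F' :
  (forall X s, F X s <-> F' X s) -> definable F -> definable F'.
Proof.
move=> FF' dF N p lN lp; have [N' [v [h [A [l [sem syn]]]]]] := dF N p lN lp.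
exists N', v, h, A; split=> //; split=> [X V iV ag|G av s /FF'/syn]; last exact.
have [? E] := sem X V iV ag; split=> // u; rewrite E.
by split=> -[s /FF' Fs ->]; exists s.
Qed.

(** * Closure properties of definable operators *)

Lemma definable_arg : definable id.
Proof.
move=> N p lN lp; exists N, (fun _ _ _ => False), One, (Var p); split=> //.
by split=> // X V [_ /= ->].
Qed.

Lemma definable_nil : definable (fun _ s => s = [::]).
Proof.
move=> N p lN lp; exists N, (fun _ _ _ => False), One, One; split=> //.
split=> [X V _ _|G _ s ->]; last exact: proves_one.
by split=> // u; split=> [->|[s -> ->]] //; exists [::].
Qed.

Lemma definable_zero : definable (fun _ s => s = [:: 0]).
Proof.
move=> N p lN lp; exists N, (fun _ _ _ => False), One, (letter false).
split=> //; split=> [X V [lV _] _|G _ s ->]; last exact: proves_id.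
split=> // u; rewrite /= (lV false).
by split=> [->|[s -> ->]] //; exists [:: 0].
Qed.

(** Division by [a] removes one letter from the first block. *)
Lemma definable_pred F :
  definable F ->
  definable (fun X s => if s is x :: s' then F X (x.+1 :: s') else False).
Proof.
move=> dF N p lN lp; have [N' [v [h [A [l [sem syn]]]]]] := dF N p lN lp.
exists N', v, h, (Under (letter true) A); split=> //.
split=> [X V iV ag|G av [|x s] // Fs]; last first.
  by apply: proves_underR; apply: (syn _ av _ Fs).
have [? E] := sem X V iV ag; split=> // u; rewrite /= (iV.1 true).
split=> [/(_ _ erefl)/E[[|[|x] s] Fs //= [->]]|].
  by exists (x :: s).
by case=> -[|x s] // Fs -> _ ->; apply/E; exists (x.+1 :: s).
Qed.

(** [F'] is built on the variables that follow those of [F], and the two hypotheses are joined by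
    [And]. *)
Lemma definable_pair F F' :
  definable F -> definable F' ->
  forall N p, 2 < N -> p < N ->
  exists N' v h A A', [/\ N <= N', captures F N p N' v h A &
                          captures F' N p N' v h A'].
Proof.
move=> dF dF' N p lN lp.
have [N1 [v [h [A [l [sem syn]]]]]] := dF N p lN lp.
have [N2 [v' [h' [A' [l' [sem' syn']]]]]] :=
  dF' N1 p (leq_trans lN l) (leq_trans lp l).
exists N2, (fun X => splice N1 (v X) (v' X)), (And h h'), A, A'.
split; [exact: leq_trans l' | split | split].
- move=> X V iV /agree_splice[] // /(sem _ _ iV)[hh E] /(sem' _ _ iV)[hh' _].
  by split.
- by move=> G /available_andl; apply: syn.
- move=> X V iV /agree_splice[] // /(sem _ _ iV)[hh _] /(sem' _ _ iV)[hh' E].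
  by split.
- by move=> G /available_andr; apply: syn'.
Qed.

Lemma definable_and F F' :
  definable F -> definable F' -> definable (fun X s => F X s /\ F' X s).
Proof.
move=> dF dF' N p lN lp.
have [N' [v [h [A [A' [l [sem syn] [sem' syn']]]]]]] :=
  definable_pair dF dF' lN lp.
exists N', v, h, (And A A'); split=> //; split=> [X V iV ag|G av s [Fs Fs']].
  have [hh E] := sem X V iV ag; have [_ E'] := sem' X V iV ag.
  split=> // u /=; rewrite E E'; split=> [[[s Fs ->] /enc_langE Fs']|].
    by exists s.
  by case=> s [Fs Fs'] ->; split; exists s.
by apply: proves_andR; [apply: syn | apply: syn'].
Qed.

Lemma agree_fresh N N' (V v : nat -> language bool) (Q : language bool) :
  N <= N' -> agree N N'.+1 V (splice N' v (fun _ => Q)) ->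
  agree N N' V v /\ V N' = Q.
Proof.
move=> l /agree_splice[] // ag1 ag2; split=> //.
by rewrite ag2 // leqnn /=.
Qed.

(** In place of a disjunction, a fresh variable [q] receives two productions, [A |- q] and
    [A' |- q]. *)
Lemma definable_or F F' :
  definable F -> definable F' -> definable (fun X s => F X s \/ F' X s).
Proof.
move=> dF dF' N p lN lp.
have [N' [v [h [A [A' [l [sem syn] [sem' syn']]]]]]] :=
  definable_pair dF dF' lN lp.
pose Q X := enc_lang (fun s => F X s \/ F' X s).
exists N'.+1, (fun X => splice N' (v X) (fun _ => Q X)),
  (And h (And (Under A (Var N')) (Under A' (Var N')))), (Var N').
split; first exact: leqW.
split=> [X V iV /(agree_fresh l)[ag VQ]|G av s].
  have [hh E] := sem X V iV ag; have [_ E'] := sem' X V iV ag.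
  split; last by move=> u /=; rewrite VQ.
  split=> //; split; apply/eval_rule1 => u /=; rewrite VQ.
    by move=> /E[s Fs ->]; exists s; first by left.
  by move=> /E'[s Fs ->]; exists s; first by right.
have avh := available_andl av; have /available_andr avr := av.
case=> [/(syn _ avh)|/(syn' _ avh)].
  exact/available_rule1/(available_andl avr).
exact/available_rule1/(available_andr avr).
Qed.

(** In place of a product, a fresh variable [q] receives the production [A, A' |- q]. *)
Lemma definable_cat F F' :
  definable F -> definable F' ->
  definable (fun X s => exists t t', [/\ s = t ++ t', F X t & F' X t']).
Proof.
move=> dF dF' N p lN lp.
have [N' [v [h [A [A' [l [sem syn] [sem' syn']]]]]]] :=
  definable_pair dF dF' lN lp.
pose Q X := enc_lang (fun s => exists t t', [/\ s = t ++ t', F X t & F' X t']).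
exists N'.+1, (fun X => splice N' (v X) (fun _ => Q X)),
  (And h (Under A' (Under A (Var N')))), (Var N').
split; first exact: leqW.
split=> [X V iV /(agree_fresh l)[ag VQ]|G av s [t [t' [-> Ft Ft']]]].
  have [hh E] := sem X V iV ag; have [_ E'] := sem' X V iV ag.
  split; last by move=> u /=; rewrite VQ.
  split=> //; apply/eval_rule2 => u u' /E[t Ft ->] /E'[t' Ft' ->].
  by rewrite /= VQ -enc_cat; exists (t ++ t') => //; exists t, t'.
have avh := available_andl av; have /available_andr avr := av.
rewrite /derived enc_cat /word map_cat.
by apply: available_rule2 avr _ _; [apply: syn | apply: syn'].
Qed.

(* The fresh variable [q] collects the words that belong to [F X] after some
   letters [a] have been put in front; it is closed under [a \ q |- q], and
   [b \ q] is the projection. *)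
Lemma definable_ex F :
  definable F -> definable (fun X s => exists x, F X (x :: s)).
Proof.
move=> dF N p lN lp; have [q [v [h [A [l [sem syn]]]]]] := dF N p lN lp.
pose Q X u := exists k, enc_lang (F X) (nseq k true ++ u).
exists q.+1, (fun X => splice q (v X) (fun _ => Q X)),
  (And h (And (Under A (Var q)) (Under (Under (letter true) (Var q)) (Var q)))),
  (Under (letter false) (Var q)).
split; first exact: leqW.
split=> [X V iV /(agree_fresh l)[ag VQ]|G av s [x Fs]].
  have [hh E] := sem X V iV ag; split; last first.
    move=> u /=; rewrite VQ (iV.1 false).
    split=> [/(_ _ erefl) [k [[|x s] Fs]]|].
    - by case: k.
    - move=> /= e; exists s; first by exists x.
      (* Comparing the positions of the first [b] gives [k = x], so the remainder is [enc s]. *)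
      by elim: k x e {Fs} => [|k IH] [|x] //= [] // /IH.
    - by case=> s [x Fs -> _ ->]; exists x, (x :: s).
  split=> //; split; apply/eval_rule1 => u /=; rewrite VQ.
    by move=> /E Fu; exists 0.
  rewrite (iV.1 true) => /(_ _ erefl)[k Fu]; exists k.+1.
  by have := Fu; rewrite /= -cat_rcons -[rcons _ _]cats1 -(nseqD k 1) addn1.
have avh := available_andl av; have /available_andr avr := av.
have /(available_rule1 (available_andl avr)) := syn _ avh _ Fs.
rewrite /= /word map_cat /= => pq; apply: proves_underR.
(* Each leading [a] is moved into a divisor and then discarded by the rule [a \ q |- q]. *)
elim: x {Fs} pq => //= x IH /proves_underR.
by move/(available_rule1 (available_andr avr)).
Qed.

(* Here [q] is the context-free language of the words [a^x b enc(s) a^x]. *)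
Lemma definable_frame F :
  definable F ->
  definable (fun X s => exists x t, s = x :: rcons t x /\ F X t).
Proof.
move=> dF N p lN lp; have [q [v [h [A [l [sem syn]]]]]] := dF N p lN lp.
pose W x t := nseq x true ++ false :: enc t ++ nseq x true.
pose Q X u := exists x t, F X t /\ u = W x t.
pose P X := enc_lang (fun s => exists x t, s = x :: rcons t x /\ F X t).
have encW x t : enc (x :: rcons t x) = W x t ++ [:: false].
  by rewrite /W /= -cats1 enc_cat /= -catA /= -catA.
(* The productions are [b, A |- q], then [a, q, a |- q], and [q, b |- q.+1], whose [b] closes the
   last block. *)
pose r0 := Under A (Under (letter false) (Var q)).
pose r1 := Under (letter true) (Under (Var q) (Under (letter true) (Var q))).
pose r2 := Under (letter false) (Under (Var q) (Var q.+1)).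
exists q.+2,
  (fun X => splice q.+1 (splice q (v X) (fun _ => Q X)) (fun _ => P X)),
  (And h (And r0 (And r1 r2))), (Var q.+1).
split; first by rewrite !leqW.
split=> [X V iV /(agree_fresh (leqW l))[/(agree_fresh l)[ag VQ] VP]|].
  have [hh E] := sem X V iV ag; split; last by move=> u; rewrite /= VP.
  split=> //; split; [|split]; apply/eval_rule2 => u u'.
  - rewrite /= (iV.1 false) VQ => -> /E[t Ft ->].
    by exists 0, t; rewrite /W /= cats0.
  - rewrite /= VQ (iV.1 true) => -[x [t [Ft ->]]] -> _ ->; exists x.+1, t.
    by split=> //; rewrite /W /= -[true :: nseq x _]/(nseq x.+1 _) -addn1 nseqD
      -catA /= -catA.
  - rewrite /= VQ VP (iV.1 false) => -[x [t [Ft ->]]] ->.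
    by rewrite -encW; exists (x :: rcons t x) => //; exists x, t.
move=> G av s [x [t [-> Ft]]].
have avh := available_andl av; have /available_andr avr := av.
have av0 := available_andl avr; have /available_andr av12 := avr.
have av1 := available_andl av12; have /available_andr av2 := av12.
rewrite /derived encW /word map_cat.
apply: available_rule2 av2 _ (proves_id _ _).
elim: x => [|x IH].
  rewrite /W /= cats0.
  exact: (available_rule2 av0 (proves_id _ (letter false)) (syn _ avh _ Ft)).
have -> : W x.+1 t = true :: W x t ++ [:: true].
  by rewrite /W /= -[true :: nseq x _]/(nseq x.+1 _) -addn1 nseqD -catA /= -catA.
rewrite /= map_cat -cat1s.
exact: available_rule3 av1 (proves_id _ (letter true)) IH
  (proves_id _ (letter true)).
Qed.

(** The argument of [F] is the fresh variable [N], with the rule [A |- N]. The rule holds in the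
    model because [R] is closed under [F]. It also closes the derivable tuples under [F], so by
    minimality they include [R]. *)
Lemma definable_fix F R :
  definable F -> (forall s, F R s -> R s) ->
  (forall X, (forall s, F X s -> X s) -> forall s, R s -> X s) ->
  definable (fun _ => R).
Proof.
move=> dF FR minR N p lN lp.
have [N' [v [h [A [l [sem syn]]]]]] := dF N.+1 N (leqW lN) (leqnn _).
exists N', (fun _ => splice N.+1 (fun _ => enc_lang R) (v R)),
  (And h (Under A (Var N))), (Var N).
split; first exact: ltnW.
split=> [X V iV /agree_splice[] // agN ag|G av].
  have VN : V N = enc_lang R by rewrite agN ?leqnn.
  have [hh E] := sem R V (conj iV.1 VN) ag.
  split; last by move=> u /=; rewrite VN.
  split=> //; apply/eval_rule1 => u /=; rewrite VN.
  by move=> /E[s Fs ->]; exists s; first exact: FR.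
apply: minR => s Fs; apply: available_rule1 (available_andr av) _.
exact: (syn _ (available_andl av) _ Fs).
Qed.

(** * Selecting and rearranging the entries of a tuple *)

Lemma definable_size n : definable (fun _ s => size s = n).
Proof.
(* All one-entry tuples, as a projection of the pairs [[:: x; x]]. *)
have d1 := definable_ex (definable_frame definable_nil).
elim: n => [|n IH].
  by apply: definable_ext definable_nil => _ [].
apply: definable_ext (definable_cat d1 IH) => _ s; split.
  by case=> t [t' [-> [x [y [_ [[_ ->] ->]]]] <-]].
by case: s => [|x s] //= [<-]; exists [:: x], s; split=> //; exists x, x, [::].
Qed.

Lemma definable_exn F k :
  definable F -> definable (fun X s => exists t, size t = k /\ F X (t ++ s)).
Proof.
elim: k F => [|k IH] F dF.
  apply: definable_ext dF => X s; split=> [Fs|]; first by exists [::].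
  by case=> t [/size0nil ->].
apply: definable_ext (IH _ (definable_ex dF)) => X s; split.
  by case=> t [<- [x Fs]]; exists (x :: t).
by case=> -[|x t] [] // [<-] Fs; exists t; split=> //; exists x.
Qed.

Lemma definable_repeat k r :
  definable (fun _ s =>
    exists x t t', [/\ s = x :: t ++ x :: t', size t = k & size t' = r]).
Proof.
have dF := definable_cat (definable_frame (definable_size k)) (definable_size r).
apply: definable_ext dF => _ s; split.
  by case=> _ [t' [-> [x [t [-> st]]] st']]; exists x, t, t'; rewrite /= cat_rcons.
case=> x [t [t' [-> st st']]]; exists (x :: rcons t x), t'.
by rewrite /= cat_rcons; split=> //; exists x, t.
Qed.

(** Each copy is a quantified first entry, forced by [definable_repeat] to equal its source. The
    bound on [sg] keeps the default of [nth] from being read. *)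
Lemma definable_prefix F n (sg : seq nat) :
  all (gtn n) sg -> definable F ->
  definable (fun X s => size s = n /\ F X ([seq nth 0 s i | i <- sg] ++ s)).
Proof.
elim: sg F => [|i sg IH] F /=.
  by move=> _ dF; apply: definable_and (definable_size n) dF.
case/andP=> lin lsg dF.
(* Between the new entry and entry [i] of [s] lie the [size sg] earlier copies and [i] entries of
   [s]; after it come [n - i.+1] more. *)
have dG := definable_ex
  (definable_and (definable_repeat (size sg + i) (n - i.+1)) dF).
apply: definable_ext (IH _ lsg dG) => X s; split=> -[sn].
  case=> x [[y [t [t' [[exy e] st _]]]] Fs]; split=> //.
  suff <- : x = nth 0 s i by []; rewrite exy.
  have := congr1 (fun w => nth 0 w (size sg + i)) e.
  rewrite !nth_cat size_map st ltnn subnn /= -[X in _ < X]addn0 ltn_add2l ltn0.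
  by rewrite addKn.
move=> Fs; split=> //; exists (nth 0 s i); split=> //.
exists (nth 0 s i), ([seq nth 0 s j | j <- sg] ++ take i s), (drop i.+1 s).
rewrite size_cat size_map size_take sn lin size_drop sn; split=> //.
by rewrite -catA -drop_nth ?sn // cat_take_drop.
Qed.

(** The original tuple still follows the copies; it is split off as an arbitrary tuple of size
    [n]. *)
Lemma definable_subst F n (sg : seq nat) :
  all (gtn n) sg -> definable F ->
  definable (fun X s => size s = n /\ F X [seq nth 0 s i | i <- sg]).
Proof.
move=> lsg dF.
have dG := definable_prefix lsg (definable_cat dF (definable_size n)).
apply: definable_ext dG => X s; split=> -[sn]; last first.
  by move=> Fs; split=> //; exists [seq nth 0 s i | i <- sg], s.
case=> t [t' [e Ft st']]; split=> //.
have /eqP := e; rewrite eqseq_cat; last first.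
  have := congr1 size e; rewrite !size_cat sn st'; exact: addIn.
by case/andP=> /eqP ->.
Qed.

(** * Graphs of partial recursive functions *)

(* The value comes first in the words of a graph: projections act on the left. *)
Definition graph n (P : n.-tuple nat -> nat -> Prop) : relation :=
  fun s => if s is y :: t then exists2 xs : n.-tuple nat, tval xs = t & P xs y
           else False.

Lemma graphE n (P : n.-tuple nat -> nat -> Prop) y (xs : n.-tuple nat) :
  graph P (y :: xs) <-> P xs y.
Proof. by split=> [[ys /val_inj ->]|Py] //; exists xs. Qed.

Lemma graph_size n (P : n.-tuple nat -> nat -> Prop) s :
  graph P s -> size s = n.+1.
Proof. by case: s => [|y t] //= [xs <- _]; rewrite size_tuple. Qed.

Lemma size_graph n s :
  size s = n.+1 -> exists y (xs : n.-tuple nat), s = y :: xs.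
Proof.
case: s => [|y t] //= [/eqP st].
by exists y, (Tuple st).
Qed.

(** Intersecting [F] with the tuples of size [n.+1] confines both fixed-point conditions to that
    size. *)
Lemma definable_graph_fix n (P : n.-tuple nat -> nat -> Prop) F :
  definable F ->
  (forall y (xs : n.-tuple nat), F (graph P) (y :: xs) -> P xs y) ->
  (forall X : relation,
     (forall y (xs : n.-tuple nat), F X (y :: xs) -> X (y :: xs)) ->
     forall y (xs : n.-tuple nat), P xs y -> X (y :: xs)) ->
  definable (fun _ => graph P).
Proof.
move=> dF FP minP.
apply: definable_fix (definable_and (definable_size n.+1) dF) _ _ => [s|X FX s].
  by case=> /size_graph[y [xs ->]] /FP Py; apply/graphE.
move=> Ps; have [y [xs e]] := size_graph (graph_size Ps).
rewrite e in Ps *; move/graphE: Ps; apply: minP => z zs Fz.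
by apply: FX; rewrite /= size_tuple.
Qed.

Lemma definable_graph n (P : n.-tuple nat -> nat -> Prop) F :
  definable F ->
  (forall X y (xs : n.-tuple nat), F X (y :: xs) <-> P xs y) ->
  definable (fun _ => graph P).
Proof.
move=> dF FP; apply: definable_graph_fix dF _ _ => [y xs /FP //|X FX y xs Py].
by apply: FX; apply/FP.
Qed.

Lemma definable_all (I : eqType) (l : seq I) F0 F :
  definable F0 -> (forall i, definable (F i)) ->
  definable (fun X s => F0 X s /\ forall i, i \in l -> F i X s).
Proof.
move=> d0 dF; elim: l => [|i l IH].
  by apply: definable_ext d0 => X s; split=> [|[]].
apply: definable_ext (definable_and (dF i) IH) => X s; split.
  by case=> Fi [? Fl]; split=> // j; rewrite inE => /orP[/eqP ->|/Fl].
case=> ? Fl; split; first by apply: Fl; rewrite mem_head.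
by split=> // j jl; apply: Fl; rewrite inE jl orbT.
Qed.

Lemma all_iota i j n : i + j <= n -> all (gtn n) (iota i j).
Proof.
move=> l; apply/allP=> x; rewrite mem_iota => /andP[_ lx].
exact: leq_trans lx l.
Qed.

Lemma map_nth_block (a b : seq nat) i n :
  size a = i -> size b = n -> [seq nth 0 (a ++ b) j | j <- iota i n] = b.
Proof.
move=> <- <-; rewrite map_nth_iota; first by rewrite drop_size_cat ?take_size.
by rewrite size_cat addKn.
Qed.

Lemma definable_eq : definable (fun _ s => exists x, s = [:: x; x]).
Proof.
apply: definable_ext (definable_frame definable_nil) => _ s; split.
  by case=> x [_ [-> ->]]; exists x.
by case=> x ->; exists x, [::].
Qed.

(** Obtained from the pairs [[:: x.+1; x.+1]] by lowering the first entry. *)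
Lemma definable_succ : definable (fun _ s => exists x, s = [:: x; x.+1]).
Proof.
apply: definable_ext (definable_pred definable_eq) => _ s; split.
  by case: s => // x s [y [<- ->]]; exists x.
by case=> x ->; exists x.+1.
Qed.

Lemma definable_Zero n : definable (fun _ => graph (computes (Zero n))).
Proof.
have d := @definable_subst _ n.+1 [:: 0] isT definable_zero.
apply: definable_graph d _ => X y xs; rewrite /= size_tuple.
by split=> [[_ []]|->].
Qed.

Lemma definable_Succ : definable (fun _ => graph (computes Succ)).
Proof.
have d := @definable_subst _ 2 [:: 1; 0] isT definable_succ.
apply: definable_graph d _ => X y; case/tupleP => x xs.
rewrite [xs]tuple0 /= /thead (tnth_nth 0) /=.
by split=> [[_ [z [-> ->]]]|->] //; split=> //; exists x.
Qed.

Lemma definable_Proj n (i : 'I_n) :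
  definable (fun _ => graph (computes (Proj i))).
Proof.
have d := @definable_subst _ n.+1 [:: 0; i.+1] _ definable_eq.
apply: definable_graph (d _) _ => [|X y xs]; first by rewrite /= ltnS ltn_ord.
rewrite /= size_tuple (tnth_nth 0).
by split=> [[_ [z [-> ->]]]|->] //; split=> //; exists (nth 0 xs i).
Qed.

Lemma definable_Comp k n (g : recfun k) (h : 'I_k -> recfun n) :
  definable (fun _ => graph (computes g)) ->
  (forall i, definable (fun _ => graph (computes (h i)))) ->
  definable (fun _ => graph (computes (Comp g h))).
Proof.
(* The words are [zs ++ y :: xs] with the intermediate values in front: [y] has index [k], and [xs]
   starts at [k.+1]. *)
move=> dg dh; pose m := k + n.+1.
have lg : all (gtn m) (k :: iota 0 k).
  by rewrite /= all_iota ?leq_addr // /m -addSnnS leq_addr.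
have lh (i : 'I_k) : all (gtn m) (val i :: iota k.+1 n).
  by rewrite /= all_iota /m ?addSnnS // (leq_trans (ltn_ord i)) ?leq_addr.
have d := definable_exn k (definable_all (enum 'I_k) (definable_subst lg dg)
  (fun i => definable_subst (lh i) (dh i))).
apply: definable_graph d _ => _ y xs.
have sz (zs : k.-tuple nat) : size (zs ++ y :: xs) = m.
  by rewrite size_cat /= !size_tuple.
have Eg (zs : k.-tuple nat) :
    [seq nth 0 (zs ++ y :: xs) j | j <- k :: iota 0 k] = y :: zs.
  rewrite /= nth_cat size_tuple ltnn subnn /=; congr cons.
  by rewrite map_nth_iota0 ?size_cat ?size_tuple ?leq_addr // take_size_cat ?size_tuple.
have Eh (zs : k.-tuple nat) (i : 'I_k) :
    [seq nth 0 (zs ++ y :: xs) j | j <- val i :: iota k.+1 n] = tnth zs i :: xs.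
  rewrite /= nth_cat size_tuple ltn_ord -tnth_nth -cat_rcons; congr cons.
  by rewrite map_nth_block ?size_rcons ?size_tuple.
split.
  case=> t [/eqP st]; rewrite -[t]/(tval (Tuple st)); move: (Tuple st) => zs.
  case=> -[_]; rewrite Eg => /graphE gy H; exists zs => // i.
  by have [_] := H i (mem_enum _ i); rewrite Eh => /graphE.
move=> [zs hz gy]; exists zs; rewrite size_tuple; split=> //.
split=> [|i _]; split; rewrite ?sz // ?Eg ?Eh; apply/graphE => //.
exact: hz.
Qed.

(** The inner recursion of [computes] at [PrimRec], named to allow rewriting and induction. *)
Definition prim_rec n (P : n.-tuple nat -> nat -> Prop)
    (Q : n.+2.-tuple nat -> nat -> Prop) (ps : n.-tuple nat) :=
  fix rec m : nat -> Prop :=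
    if m is m'.+1 then
      fun y => exists2 z, rec m' z & Q [tuple of m' :: z :: ps] y
    else P ps.

Lemma computes_PrimRec n (g : recfun n) h m (ps : n.-tuple nat) :
  computes (PrimRec g h) [tuple of m :: ps] =
  prim_rec (computes g) (computes h) ps m.
Proof.
have e : [tuple of behead [tuple of m :: ps]] = ps by apply: val_inj.
by rewrite -[in RHS]e.
Qed.

Lemma definable_PrimRec n (g : recfun n) h :
  definable (fun _ => graph (computes g)) ->
  definable (fun _ => graph (computes h)) ->
  definable (fun _ => graph (computes (PrimRec g h))).
Proof.
move=> dg dh.
have l2 : all (gtn n.+2) (0 :: iota 2 n) by rewrite /= all_iota.
have l4 (sg : seq nat) : all (gtn 4) sg -> all (gtn n.+4) (sg ++ iota 4 n).
  move=> /allP ls; rewrite all_cat all_iota // andbT.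
  by apply/allP=> i /ls /= li; apply: leq_trans li _.
have d0 := definable_and (@definable_subst _ n.+2 [:: 1] isT definable_zero)
                         (definable_subst l2 dg).
(* On [[:: z, m', y, m & ps]]: [m] is [m'.+1], the argument of the operator relates [z] to [m'] and
   [ps], and [h] yields [y] from [m'], [z] and [ps]. *)
have dS := definable_ex (definable_ex (definable_and
  (@definable_subst _ n.+4 [:: 1; 3] isT definable_succ) (definable_and
  (definable_subst (l4 [:: 0; 1] isT) definable_arg)
  (definable_subst (l4 [:: 2; 1; 0] isT) dh)))).
have E2 y m (ps : n.-tuple nat) :
  [seq nth 0 [:: y, m & ps] i | i <- iota 2 n] = ps.
  by rewrite (@map_nth_block [:: y; m]) ?size_tuple.
have E4 z m' y m (ps : n.-tuple nat) :
  [seq nth 0 [:: z, m', y, m & ps] i | i <- iota 4 n] = ps.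
  by rewrite (@map_nth_block [:: z; m'; y; m]) ?size_tuple.
apply: definable_graph_fix (definable_or d0 dS) _ _ => [y|X FX y];
  case/tupleP => m ps.
  case=> [[[_ [m0]] [_]]|[m' [z [[_ [x [<- mS]]] [[_]]]]]].
    rewrite /= in m0; rewrite m0 map_cons E2 => /graphE gy.
    by rewrite computes_PrimRec.
  rewrite /= in mS; rewrite mS !map_cat E4.
  move=> /(graphE _ _ [tuple of m' :: ps]) rz [_].
  move=> /(graphE _ _ [tuple of m' :: z :: ps]) hy.
  by rewrite computes_PrimRec in rz; rewrite computes_PrimRec; exists z.
rewrite computes_PrimRec; elim: m y => [|m IH] y /=.
  move=> gy; apply: FX; left; rewrite /= size_tuple E2; split=> //.
  by split=> //; apply/graphE.
case=> z /IH Xz hy; apply: FX; right; exists m, z.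
rewrite /= size_tuple E4; split; [by split=> //; exists m | split=> //].
by split=> //; apply/(graphE _ _ [tuple of m :: z :: ps]).
Qed.

Lemma definable_Mu n (g : recfun n.+1) :
  definable (fun _ => graph (computes g)) ->
  definable (fun _ => graph (computes (Mu g))).
Proof.
move=> dg.
(* The bounded universal quantifier becomes a least fixed point: [B] holds at 0 and passes from [i]
   to [i.+1] when [g] has a positive value at [i]. *)
pose B (xs : n.-tuple nat) y :=
  forall i, i < y -> exists z, computes g [tuple of i :: xs] z.+1.
have l1 : all (gtn n.+1) (iota 0 n.+1) by rewrite all_iota.
have l3 (sg : seq nat) : all (gtn 3) sg -> all (gtn n.+3) (sg ++ iota 3 n).
  move=> /allP ls; rewrite all_cat all_iota // andbT.
  by apply/allP=> i /ls /= li; apply: leq_trans li _.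
have E3 z i y (xs : n.-tuple nat) :
  [seq nth 0 [:: z, i, y & xs] j | j <- iota 3 n] = xs.
  by rewrite (@map_nth_block [:: z; i; y]) ?size_tuple.
have d0 := @definable_subst _ n.+1 [:: 0] isT definable_zero.
(* On [[:: z, i, y & xs]]; [definable_pred] makes the value of [g] equal to [z.+1]. *)
have dS := definable_ex (definable_ex (definable_and
  (@definable_subst _ n.+3 [:: 1; 2] isT definable_succ) (definable_and
  (definable_subst (l3 [:: 1] isT) definable_arg)
  (definable_subst (l3 [:: 0; 1] isT) (definable_pred dg))))).
have dB : definable (fun _ => graph B).
  apply: definable_graph_fix (definable_or d0 dS) _ _ => [y xs|X FX y xs].
    case=> [[_ [->]] //|[i [z [[_ [x [<- yS]]] [[_]]]]]].
    rewrite /= in yS; rewrite yS !map_cat E3 => /graphE Bi [_].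
    move=> /(graphE _ _ [tuple of i :: xs]) gi j; rewrite ltnS leq_eqVlt.
    by case/orP=> [/eqP ->|/Bi]; first by exists z.
  elim: y => [|y IH] By; apply: FX.
    by left; rewrite /= size_tuple.
  have [z gz] := By y (leqnn _).
  right; exists y, z; rewrite /= size_tuple E3.
  split; [by split=> //; exists y | split; split=> //].
    by apply: IH => i ly; apply: By; apply: leqW.
  by apply/(graphE _ _ [tuple of y :: xs]).
have dz := definable_ex (definable_and
  (@definable_subst _ n.+2 [:: 0] isT definable_zero)
  (definable_and dg (@definable_subst _ n.+2 (iota 1 n.+1) _ dB))).
apply: definable_graph (dz _) _ => [|X y xs]; first by rewrite all_iota.
have E1 z : [seq nth 0 [:: z, y & xs] i | i <- iota 1 n.+1] = y :: xs.
  by rewrite (@map_nth_block [:: z]) //= size_tuple.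
split=> [[z [[_ z0] [gz [_]]]]|[gy By]].
  rewrite E1 => /graphE By; split=> //; case: z0 gz => /= ->.
  by move/(graphE _ _ [tuple of y :: xs]).
exists 0; rewrite E1 /= size_tuple; split=> //; split.
  exact/(graphE _ _ [tuple of y :: xs]).
by split=> //; apply/graphE.
Qed.

Lemma definable_computes n (f : recfun n) :
  definable (fun _ => graph (computes f)).
Proof.
elim: f => {n} [n||n i|k n g dg h dh|n g dg h dh|n g dg].
- exact: definable_Zero.
- exact: definable_Succ.
- exact: definable_Proj.
- exact: definable_Comp.
- exact: definable_PrimRec.
- exact: definable_Mu.
Qed.

(** * Recursiveness of the codes of queries *)

Definition total n (F : n.-tuple nat -> nat) : Prop :=
  exists f : recfun n, forall xs, computes f xs (F xs).

Lemma total_ext n (F F' : n.-tuple nat -> nat) :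
  F =1 F' -> total F -> total F'.
Proof. by move=> FF' [f fF]; exists f => xs; rewrite -FF'. Qed.

Lemma total_proj n (i : 'I_n) : total (fun xs => tnth xs i).
Proof. by exists (Proj i). Qed.

Lemma total_comp k n (F : k.-tuple nat -> nat) (H : 'I_k -> n.-tuple nat -> nat) :
  total F -> (forall i, total (H i)) ->
  total (fun xs => F [tuple H i xs | i < k]).
Proof.
move=> [f fF] /fin_all_exists[h hH]; exists (Comp f h) => xs /=.
by exists [tuple H i xs | i < k] => // i; rewrite tnth_mktuple.
Qed.

Lemma total_comp1 n (F : nat -> nat) (a : n.-tuple nat -> nat) :
  total (fun xs : 1.-tuple nat => F (thead xs)) -> total a ->
  total (fun xs => F (a xs)).
Proof.
move=> tF ta; apply: total_ext (total_comp tF (fun _ => ta)) => xs.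
by rewrite /thead tnth_mktuple.
Qed.

Lemma total_comp2 n (F : nat -> nat -> nat) (a b : n.-tuple nat -> nat) :
  total (fun xs : 2.-tuple nat => F (thead xs) (tnth xs ord_max)) ->
  total a -> total b -> total (fun xs => F (a xs) (b xs)).
Proof.
move=> tF ta tb.
have tab (i : 'I_2) : total (if i == ord0 then a else b) by case: ifP.
by apply: total_ext (total_comp tF tab) => xs; rewrite /thead !tnth_mktuple.
Qed.

Lemma total_succ n (a : n.-tuple nat -> nat) :
  total a -> total (fun xs => (a xs).+1).
Proof. by apply: total_comp1; exists Succ. Qed.

Lemma total_const n c : total (fun _ : n.-tuple nat => c).
Proof. by elim: c => [|c]; [exists (Zero n) | apply: total_succ]. Qed.

Lemma total_primrec n (K : nat -> n.-tuple nat -> nat)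
    (G : n.-tuple nat -> nat) (H : n.+2.-tuple nat -> nat) :
  total G -> total H -> K 0 =1 G ->
  (forall m ps, K m.+1 ps = H [tuple of m :: K m ps :: ps]) ->
  total (fun xs => K (thead xs) [tuple of behead xs]).
Proof.
move=> [g gG] [h hH] K0 KS; exists (PrimRec g h); case/tupleP=> m ps.
rewrite computes_PrimRec theadE.
have -> : [tuple of behead [tuple of m :: ps]] = ps by apply: val_inj.
elim: m => [|m IH] /=; first by rewrite K0.
by exists (K m ps); rewrite ?KS.
Qed.

Lemma total_add n (a b : n.-tuple nat -> nat) :
  total a -> total b -> total (fun xs => a xs + b xs).
Proof.
apply: (total_comp2 (F := addn)).
have tK := @total_primrec 1 (fun m ps => m + thead ps) _ _
  (total_proj ord0) (total_succ (total_proj (inord 1))).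
apply: total_ext (tK _ _) => // [xs|m ps].
  by rewrite /thead !(tnth_nth 0) /= nth_behead.
by rewrite (tnth_nth 0) inordK.
Qed.

(** By Pascal's rule, the triangular numbers satisfy a primitive recursion that adds [m.+1]. *)
Lemma total_triangle n (a : n.-tuple nat -> nat) :
  total a -> total (fun xs => 'C((a xs).+1, 2)).
Proof.
apply: (total_comp1 (F := fun m => 'C(m.+1, 2))).
apply: (@total_primrec 0 (fun m _ => 'C(m.+1, 2)) _ _ (total_const 0 0)
  (total_succ (total_add (total_proj ord0) (total_proj ord_max)))) => // m ps.
by rewrite binS bin1 !(tnth_nth 0) /= addnC addSn.
Qed.

Lemma total_cpair n (a b : n.-tuple nat -> nat) :
  total a -> total b -> total (fun xs => cpair (a xs) (b xs)).
Proof.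
move=> ta tb; exact: total_add (total_triangle (total_add ta tb)) tb.
Qed.

Lemma total_iter_cpair n c (a b : n.-tuple nat -> nat) :
  total a -> total b ->
  total (fun xs => iter (a xs) (fun y => (cpair c y).+1) (b xs)).
Proof.
apply: (total_comp2 (F := fun m t => iter m (fun y => (cpair c y).+1) t)).
have tK := @total_primrec 1
  (fun m ps => iter m (fun y => (cpair c y).+1) (thead ps)) _ _
  (total_proj ord0)
  (total_succ (total_cpair (total_const _ c) (total_proj (inord 1)))).
apply: total_ext (tK _ _) => // [xs|m ps].
  by rewrite /thead !(tnth_nth 0) /= nth_behead.
by rewrite (tnth_nth 0) inordK.
Qed.

(** * The diagonal argument *)

Definition query G s : sequent := (word (enc s) ++ [:: And One G], Var 2).

(** The code of [a^x b, H |- p] when [x] is the code of the sequence [H]: [x] is both the length of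
    the block and the code of the tail. *)
Definition diagonal_code (x : nat) : nat :=
  cpair (iter x (fun y => (cpair (code_formula (letter true)) y).+1)
              (cpair (code_formula (letter false)) x).+1)
        (code_formula (Var 2)).

Lemma code_seq_block x Gamma :
  code_seq (word (enc [:: x]) ++ Gamma) =
  iter x (fun y => (cpair (code_formula (letter true)) y).+1)
         (cpair (code_formula (letter false)) (code_seq Gamma)).+1.
Proof. by elim: x => [|x IH] //; rewrite iterS -IH. Qed.

Lemma code_query G :
  code_sequent (query G [:: code_seq [:: And One G]]) =
  diagonal_code (code_seq [:: And One G]).
Proof. by rewrite /diagonal_code -code_seq_block. Qed.

Lemma total_diagonal_code :
  total (fun xs : 1.-tuple nat => diagonal_code (thead xs)).
Proof.
have tx := total_proj (@ord0 0).
exact: total_cpair (total_iter_cpair _ tx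
  (total_succ (total_cpair (total_const _ _) tx))) (total_const _ _).
Qed.

(** The rule [A |- p] is added to the theory [h]. In the intended model, with [p] read as [R], this
    theory holds at the empty word, so truth of a query there gives membership in [R]. *)
Lemma definable_query R :
  definable (fun _ => R) ->
  exists G, (forall s, R s -> proves G (word (enc s)) (Var 2)) /\
    (forall s, (forall Sigma (w : Leps_model Sigma), true_in w (query G s)) ->
               R s).
Proof.
move=> dR; have [N [v [h [A [l [sem syn]]]]]] := dR 3 2 isT isT.
pose G := And h (Under A (Var 2)); have av := available_self (G := G).
exists G; split=> s.
  move=> Rs; apply: available_rule1 (available_andr av) _.
  exact: (syn _ (available_andl av)).
(* For variables 0 and 1, [i == 1] inverts the coercion of [bool] to [nat]. *)
pose V0 i := if i == 2 then enc_lang R else fun u => u = [:: i == 1].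
pose V := splice 3 V0 (v R).
have iV : intended 2 R V by split=> // -[].
have ag : agree 3 N V (v R) by move=> i /andP[li _]; rewrite /V /splice ltnNge li.
have [hh E] := sem _ _ iV ag.
have hG : eval V G [::].
  by split=> //; apply/eval_rule1 => u /E.
move=> /(_ bool (eval_model V) (enc s)) /= trueV.
apply/enc_langE; apply: trueV.
elim: (enc s) => [|c u IH] /=; first by exists [::], [::].
by exists [:: c], u; split=> //; case: c.
Qed.

Theorem theorem8 (L : sequent -> Prop) (hsound : Leps_sound L)
    (hincl : includes_Leps_calculus L) :
  ~ derivability_decidable L.
Proof.
case=> f decf; have [d dP] := total_diagonal_code.
pose R s := exists2 x, s = [:: x] & computes f [tuple diagonal_code x] 0.
have dR : definable (fun _ => R).
  have dfd := definable_computes (Comp f (fun _ => d)).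
  (* The value, which is the first entry, is fixed to 0 and projected away. *)
  apply: definable_ext (definable_ex (definable_and
    (@definable_subst _ 2 [:: 0] isT definable_zero) dfd)) => _ s.
  split=> [[y [[ss [/= ->]] [xs <-]]]|[x -> fx]].
    case/tupleP: xs => x xs; rewrite [xs]tuple0 => -[zs zsP fz].
    exists x => //; congr (computes f _ _): fz; apply: eq_from_tnth => i.
    by rewrite (computes_functional (zsP i) (dP _)) ord1.
  exists 0; split=> //; apply/(graphE _ _ [tuple x]).
  by exists [tuple diagonal_code x] => // i; rewrite ord1; apply: dP.
have [G [complete sound]] := definable_query dR.
pose x := code_seq [:: And One G].
have [Lf nLf] := decf (query G [:: x]).
(* [L] lies between derivability and truth in all models, and both bounds amount to [R] on
   queries. *)
have RL : R [:: x] -> L (query G [:: x]) by move/complete/hincl.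
have LR : L (query G [:: x]) -> R [:: x].
  by move=> /hsound Ls; apply: sound => Sigma w; apply: Ls.
rewrite code_query -/x in Lf nLf.
(* Membership would make [f] return both 0 and 1. Its failure makes [f] return 0, which places the
   query in [L]. *)
have nL : ~ L (query G [:: x]).
  by move=> Lq; have [_ [<-] f0] := LR Lq; have := computes_functional f0 (Lf Lq).
by apply: (nL); apply: RL; exists x; last exact: nLf.
Qed.
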